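(* Let $E$ be a finite set of $n$ points in $\mathbb{R}^3$ (with $n$ large). Then the number of tuples $(x_1,\dots,x_5)\in E^5$ with $\angle(x_j,x_{j+1},x_{j+2})=\pi/2$ for $j=1,2,3$ is $\lesssim n^4$.
   Context: $\angle(x,y,z)\in[0,\pi]$ denotes the angle at $y$ between $x-y$ and $z-y$ (for $x\ne y\ne z$). $X\lesssim Y$ means $X\le CY$ for all $n>N$ with constants $C,N$ independent of $n$. *)

(* Defs.v *)
From mathcomp Require Import all_boot all_order all_algebra.
From mathcomp Require Import finmap.
From mathcomp Require Import reals trigo.

Set Implicit Arguments.
Unset Strict Implicit.
Unset Printing Implicit Defensive.

Import Order.TTheory GRing.Theory Num.Theory.
Local Open Scope ring_scope.

Definition dotprod (R : realType) (d : nat) (u v : 'rV[R]_d) : R :=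
  \sum_(i < d) u 0 i * v 0 i.

(* MathComp-Analysis equips 'rV[R]_d with the sup norm, hence this definition. *)
Definition euclid_norm (R : realType) (d : nat) (u : 'rV[R]_d) : R :=
  Num.sqrt (dotprod u u).

Definition angle (R : realType) (d : nat) (x y z : 'rV[R]_d) : R :=
  acos (dotprod (x - y) (z - y) / (euclid_norm (x - y) * euclid_norm (z - y))).

(* If x = y or z = y then angle x y z is acos (0 / 0) = acos 0 = pi / 2, so the
   non-degeneracy conditions, under which the angle is defined on paper, matter
   here. *)
Definition has_angle (R : realType) (d : nat) (a : R) (x y z : 'rV[R]_d) : bool :=
  [&& x != y, y != z & angle x y z == a].

(* Main.v *)
(** The tuples are counted by deleting one coordinate. Put d = x1 - x2 and
    e = x5 - x4. The right angles place x3 on the plane through x2 normal to d,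
    on the plane through x4 normal to e, and on the sphere with diameter x2 x4.
    If d and e are not parallel, the planes meet in a line, which meets the
    sphere in at most two points, so (x1, x2, x4, x5) leaves at most two choices
    for x3. If they are parallel, then x4 is the foot of the perpendicular from
    x3 to the line through x5 of direction d, so (x1, x2, x3, x5) determines x4.
    This gives at most 2 n^4 + n^4 tuples. *)

Require Import Defs.
From mathcomp Require Import all_boot all_order all_algebra.
From mathcomp Require Import finmap.
From mathcomp Require Import reals trigo.
From mathcomp Require Import zify lra.
From mathcomp Require classical_sets.

Set Implicit Arguments.
Unset Strict Implicit.
Unset Printing Implicit Defensive.

Import Order.TTheory GRing.Theory Num.Theory.
Local Open Scope ring_scope.

Section DotProduct.
Variables (R : realType) (d : nat).
Implicit Types (u v w x y z : 'rV[R]_d) (a : R).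

Lemma dotprodC u v : dotprod u v = dotprod v u.
Proof. by apply: eq_bigr => i _; rewrite mulrC. Qed.

Lemma dotprodBl u v w : dotprod (u - v) w = dotprod u w - dotprod v w.
Proof. by rewrite /dotprod -sumrB; apply: eq_bigr => i _; rewrite !mxE mulrBl. Qed.

Lemma dotprodBr u v w : dotprod w (u - v) = dotprod w u - dotprod w v.
Proof. by rewrite !(dotprodC w) dotprodBl. Qed.

Lemma dotprodZl a u v : dotprod (a *: u) v = a * dotprod u v.
Proof. by rewrite /dotprod mulr_sumr; apply: eq_bigr => i _; rewrite !mxE mulrA. Qed.

Lemma dotprodZr a u v : dotprod u (a *: v) = a * dotprod u v.
Proof. by rewrite !(dotprodC u) dotprodZl. Qed.

Lemma dotprod_ge0 u : 0 <= dotprod u u.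
Proof. by apply: sumr_ge0 => i _; rewrite -expr2 sqr_ge0. Qed.

Lemma dotprod_eq0 u : (dotprod u u == 0) = (u == 0).
Proof.
apply/eqP/eqP => [u0|->]; last by rewrite -(scale0r 0) dotprodZl mul0r.
apply/rowP => i; rewrite mxE; apply/eqP; rewrite -(sqrf_eq0 (u 0 i)) expr2.
by rewrite (psumr_eq0P _ u0) // => j _; rewrite -expr2 sqr_ge0.
Qed.

(** Restates orthogonality as a vanishing matrix product, so that rank counting on [kermx] applies
    to it. *)
Lemma mulmx_tr_dotprod u v : u *m v^T = (dotprod u v)%:M :> 'M[R]_1.
Proof.
apply/matrixP => i j; rewrite !ord1 !mxE eqxx mulr1n.
by apply: eq_bigr => k _; rewrite !mxE.
Qed.

Lemma has_angle_pihalf x y z :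
  has_angle (pi / 2) x y z -> [/\ x != y, y != z & dotprod (x - y) (z - y) = 0].
Proof.
case/and3P => xy yz /eqP axyz; split=> //.
have nu : euclid_norm (x - y) != 0.
  by rewrite gt_eqF // sqrtr_gt0 lt_neqAle dotprod_ge0 eq_sym dotprod_eq0 subr_eq0 xy.
have nv : euclid_norm (z - y) != 0.
  by rewrite gt_eqF // sqrtr_gt0 lt_neqAle dotprod_ge0 eq_sym dotprod_eq0 subr_eq0
    eq_sym yz.
(* [acos] takes the value [0] outside [[-1, 1]], so [angle x y z = pi / 2] already
   excludes this case: no Cauchy-Schwarz is needed. *)
move: axyz; rewrite /angle unlock; case: classical_sets.xgetP => [t -> [_ ct] tpi|_ tpi].
  move: ct; rewrite tpi cos_pihalf => /esym/eqP.
  by rewrite mulf_eq0 invr_eq0 mulf_eq0 (negPf nu) (negPf nv) !orbF => /eqP.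
by have := divr_gt0 (pi_gt0 R) (ltr0n R 2); rewrite -tpi ltxx.
Qed.

(** The points [0], [w] and [s *: w] lie on the sphere with diameter [u], [v]. Expanding the
    condition at [w] gives [<u + v, w> = <w, w>]; the condition at [s *: w] then becomes
    [s (s - 1) <w, w> = 0]. *)
Lemma sphere_line_meet2 (u v w : 'rV[R]_d) (s : R) : w != 0 ->
    dotprod u v = 0 -> dotprod (u - w) (v - w) = 0 ->
    dotprod (u - s *: w) (v - s *: w) = 0 ->
  s = 0 \/ s = 1.
Proof.
rewrite -dotprod_eq0 => w0.
rewrite !(dotprodBl, dotprodBr, dotprodZl, dotprodZr) => uv h1 hs.
have : s * (s - 1) * dotprod w w == 0 by apply/eqP; nra.
rewrite !mulf_eq0 (negPf w0) orbF subr_eq0.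
by case/orP => /eqP; [left|right].
Qed.

End DotProduct.

Section ThreeSpace.
Variable R : realType.
Implicit Types u v w d e p q r : 'rV[R]_3.

(** Two independent vectors of 3-space have an orthogonal complement of dimension at most 1, which
    any nonzero [w] in it spans. *)
Lemma orthogonal2_collinear d e w w' : d != 0 -> ~~ (e <= d)%MS ->
    dotprod w d = 0 -> dotprod w e = 0 -> dotprod w' d = 0 -> dotprod w' e = 0 ->
    w != 0 ->
  (w' <= w)%MS.
Proof.
move=> d0 ed wd we w'd w'e w0.
pose A := col_mx d e.
have ker x : dotprod x d = 0 -> dotprod x e = 0 -> (x <= kermx A^T)%MS.
  move=> xd xe; apply/sub_kermxP.
  by rewrite tr_col_mx mul_mx_row !mulmx_tr_dotprod xd xe raddf0 row_mx0.
have rA : (1 < \rank A)%N.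
  have : (d < A)%MS by rewrite ltmxE -!addsmxE addsmxSl addsmx_sub submx_refl.
  by move/rank_ltmx; rewrite rank_rV d0.
(* Either [w] spans the kernel, or [1 < 3 - \rank A], which contradicts [rA]. *)
have /leqifP := mxrank_leqif_eq (ker w wd we).
rewrite mxrank_ker mxrank_tr rank_rV w0.
case: ifP => [/andP[_ kw] _|_]; first exact: submx_trans (ker w' w'd w'e) kw.
lia.
Qed.

(** With [p] as origin, [q - p] and [r - p] are orthogonal to both normals, so
    [r - p = s *: (q - p)]. The sphere then forces [s = 0], that is [r = p], or [s = 1], that is
    [r = q]. *)
Lemma planes_sphere_meet2 d e u v p q r : d != 0 -> ~~ (e <= d)%MS ->
    (forall x, x \in [:: p; q; r] ->
      [/\ dotprod d (x - u) = 0, dotprod (u - x) (v - x) = 0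
        & dotprod (x - v) e = 0]) ->
  p != q -> q != r -> r != p -> False.
Proof.
move=> d0 ed H pq qr rp.
have [|p1 p2 p3] := H p; first by rewrite !inE eqxx.
have [|q1 q2 q3] := H q; first by rewrite !inE eqxx orbT.
have [|r1 r2 r3] := H r; first by rewrite !inE eqxx !orbT.
have orth x : dotprod d (x - u) = 0 -> dotprod (x - v) e = 0 ->
    dotprod (x - p) d = 0 /\ dotprod (x - p) e = 0.
  move: p1 p3; rewrite (dotprodC (x - p) d) !(dotprodBl, dotprodBr).
  by move=> *; split; lra.
have [qd qe] := orth q q1 q3; have [rd re] := orth r r1 r3.
have w0 : q - p != 0 by rewrite subr_eq0 eq_sym.
have /sub_rVP[s rs] := orthogonal2_collinear d0 ed qd qe rd re w0.
have shift x y : y - x = (y - p) - (x - p) by rewrite opprB addrA subrK.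
rewrite (shift q u) (shift q v) in q2.
rewrite (shift r u) (shift r v) rs in r2.
have [s0|s1] := sphere_line_meet2 w0 p2 q2 r2.
  by move/eqP: rs; rewrite s0 scale0r subr_eq0 (negPf rp).
by move/eqP: rs; rewrite s1 scale1r (inj_eq (addIr _)) eq_sym (negPf qr).
Qed.

End ThreeSpace.

(** Since [p != z], orthogonality to [z - p] is orthogonality to [d]. Hence [x - y] is both a
    multiple of [d] and orthogonal to [d]. *)
Lemma foot_unique (R : realType) n (d v x y z : 'rV[R]_n) : d != 0 ->
    (forall p, p \in [:: x; y] ->
      [/\ (z - p <= d)%MS, p != z & dotprod (v - p) (z - p) = 0]) ->
  x = y.
Proof.
move=> d0 H.
have main p : p \in [:: x; y] -> exists2 t, z - p = t *: d & dotprod (v - p) d = 0.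
  case/H => /sub_rVP[t zp] pz; rewrite zp dotprodZr => /eqP.
  rewrite mulf_eq0 => /orP[/eqP t0|/eqP]; last by exists t.
  by move/eqP: zp; rewrite t0 scale0r subr_eq0 eq_sym (negPf pz).
have [|t xt xd] := main x; first by rewrite !inE eqxx.
have [|t' yt yd] := main y; first by rewrite !inE eqxx orbT.
have xy : x - y = (t' - t) *: d.
  by rewrite scalerBl -xt -yt opprB [RHS]addrC addrA subrK.
have : dotprod (x - y) d = 0 by move: xd yd; rewrite !dotprodBl; lra.
rewrite xy dotprodZl => /eqP; rewrite mulf_eq0 dotprod_eq0 (negPf d0) orbF.
by move=> /eqP t0; apply/eqP; rewrite -subr_eq0 xy t0 scale0r.
Qed.

Lemma leq_card_fibers (aT rT : finType) (f : aT -> rT) (A : {set aT}) (k : nat) :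
  (forall y, #|[set x in A | f x == y]| <= k)%N -> (#|A| <= k * #|rT|)%N.
Proof.
move=> fk; rewrite -sum1_card (partition_big f predT) //= mulnC -sum_nat_const.
apply: leq_sum => y _; apply: leq_trans (fk y).
by rewrite -sum1_card; apply/eq_leq/eq_bigl => x; rewrite inE.
Qed.

Definition forget (T : Type) (n : nat) (k : 'I_n.+1) (x : {ffun 'I_n.+1 -> T}) :
  {ffun 'I_n -> T} := [ffun i => x (lift k i)].

Lemma forget_eq (T : Type) n (k : 'I_n.+1) (x y : {ffun 'I_n.+1 -> T}) j :
  forget k x = forget k y -> j != k -> x j = y j.
Proof.
move=> /ffunP xy; rewrite eq_sym => /unlift_some[i -> _].
by have := xy i; rewrite !ffunE.
Qed.

Lemma forget_inj (T : Type) n (k : 'I_n.+1) (x y : {ffun 'I_n.+1 -> T}) :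
  forget k x = forget k y -> x k = y k -> x = y.
Proof.
move=> xy xyk; apply/ffunP => j; have [->//|jk] := eqVneq j k.
exact: forget_eq xy jk.
Qed.

Theorem theorem4p6 (R : realType) :
  exists (C : R) (N : nat), forall (n : nat) (E : {fset 'rV[R]_3}),
    #|` E|%fset = n -> (N < n)%N ->
    #|[set x : {ffun 'I_5 -> E} |
        [forall j : 'I_3,
           has_angle (pi / 2) (val (x (inord j)))
             (val (x (inord j.+1))) (val (x (inord j.+2)))]]|%:R
      <= C * n%:R ^+ 4.
Proof.
exists 3, 0%N => n E En _.
set S := finset _.
pose pt (x : {ffun 'I_5 -> E}) k : 'rV[R]_3 := val (x (inord k)).
have angleS x : x \in S -> forall j, (j < 3)%N ->
    [/\ pt x j != pt x j.+1, pt x j.+1 != pt x j.+2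
      & dotprod (pt x j - pt x j.+1) (pt x j.+2 - pt x j.+1) = 0].
  rewrite inE => /forallP Sx j j3.
  exact: has_angle_pihalf (Sx (Ordinal j3)).
(* The parallel case. Indices start at 0, so [pt x 0] is x1 and the two vectors compared are e = x5
   - x4 and d = x1 - x2. *)
pose P := [set x in S | (pt x 4 - pt x 3 <= pt x 0 - pt x 1)%MS].
have pt_forget k x y j : (j < 5)%N -> (k < 5)%N -> j != k ->
    forget (inord k) x = forget (inord k) y -> pt x j = pt y j.
  move=> j5 k5 jk xy; congr val; apply: forget_eq xy _.
  by apply: contra jk => /eqP/(congr1 val); rewrite /= !inordK // => ->.
have pt_inj k x y : forget (inord k) x = forget (inord k) y ->
    pt x k = pt y k -> x = y.
  by move=> xy /val_inj; apply: forget_inj.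
have card4 : #|{ffun 'I_4 -> E}| = (n ^ 4)%N.
  by rewrite card_ffun card_ord -cardfE En.
have cardN : (#|S :\: P| <= 2 * n ^ 4)%N.
  rewrite -card4; apply: (leq_card_fibers (f := forget (inord 2))) => y.
  (* Three tuples in one fibre share x1, x2, x4, x5, hence d and e; non-parallelism is therefore
     only retained for [a]. *)
  rewrite leqNgt; apply/card_gt2P => -[a [b [c [[]]]]].
  move=> /setIdP[/setDP[Sa]] + /eqP ay /setIdP[/setDP[Sb _] /eqP by_]
    /setIdP[/setDP[Sc _] /eqP cy].
  rewrite inE Sa /= => nPa [ab bc ca].
  have neq u v : forget (inord 2) u = y -> forget (inord 2) v = y -> u != v ->
      pt u 2 != pt v 2.
    by move=> uy vy; apply: contra => /eqP uv; apply/eqP/(pt_inj 2) => //; rewrite uy.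
  apply: (@planes_sphere_meet2 R (pt a 0 - pt a 1) (pt a 4 - pt a 3) (pt a 1)
    (pt a 3) (pt a 2) (pt b 2) (pt c 2)) => //; try exact: neq.
    by rewrite subr_eq0; have [] := angleS a Sa 0 isT.
  have on_planes x : x \in S -> forget (inord 2) x = y ->
      [/\ dotprod (pt a 0 - pt a 1) (pt x 2 - pt a 1) = 0,
          dotprod (pt a 1 - pt x 2) (pt a 3 - pt x 2) = 0
        & dotprod (pt x 2 - pt a 3) (pt a 4 - pt a 3) = 0].
    move=> Sx xy; rewrite !(pt_forget 2 a x) // ?ay //.
    (* The angles at x2, x3, x4 give the first plane, the sphere and the second plane. *)
    by split; [case: (angleS x Sx 0 isT)|case: (angleS x Sx 1 isT)
      |case: (angleS x Sx 2 isT)].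
  by move=> x; rewrite !inE => /or3P[] /eqP ->; apply: on_planes.
have cardP : (#|P| <= 1 * n ^ 4)%N.
  rewrite -card4; apply: (leq_card_fibers (f := forget (inord 3))) => y.
  apply/card_le1_eqP => a b.
  move=> /setIdP[Pa /eqP ay] /setIdP[Pb /eqP by_].
  apply: (pt_inj 3); first by rewrite ay.
  (* The direction d is common to the fibre, whereas e varies with the deleted x4; membership in [P]
     keeps x4 on the line through x5 with direction d. *)
  have on_line x : x \in P -> forget (inord 3) x = y ->
      [/\ (pt a 4 - pt x 3 <= pt a 0 - pt a 1)%MS, pt x 3 != pt a 4
        & dotprod (pt a 2 - pt x 3) (pt a 4 - pt x 3) = 0].
    move=> /setIdP[Sx dx] xy; rewrite !(pt_forget 3 a x) // ?ay //.
    have [_ ? ?] := angleS x Sx 2 isT.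
    by split.
  apply: (@foot_unique R 3 (pt a 0 - pt a 1) (pt a 2) _ _ (pt a 4)).
    have /setIdP[Sa _] := Pa.
    by rewrite subr_eq0; have [] := angleS a Sa 0 isT.
  by move=> p; rewrite !inE => /orP[] /eqP ->; apply: on_line.
rewrite -natrX -natrM ler_nat -(cardsID P S).
(* As [P] lies inside [S], the two fibre bounds add up to the constant 3. *)
rewrite (setIidPr _); last by apply/subsetP => x; rewrite inE => /andP[].
by lia.
Qed.
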